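(* Let $L$ be a finitely generated $R$-module and $I$ an ideal of $R$. For almost all $\alpha$ we have $(0_L:I)_\alpha\cong 0_{L_\alpha}:I_\alpha$ and $(IL)_\alpha\cong I_\alpha L_\alpha$.
   Context: Let $k$ be an arbitrary infinite field, $u=(u_1,\ldots,u_m)$ and $x=(x_1,\ldots,x_n)$ indeterminates, and $R=k(u)[x]$. Let $K$ be an extension field of $k$; for $\alpha\in K^m$ put $R_\alpha=k(\alpha)[x]$. A property holds for almost all $\alpha$ if it holds for all $\alpha\in K^m$ except perhaps those lying on a proper algebraic subvariety of $K^m$ (which may depend on the given data). Every $a\in R$ can be written $a(u,x)=p(u,x)/q(u)$ with $p\in k[u,x]$, $q\in k[u]\setminus\{0\}$; for $\alpha$ with $q(\alpha)\neq 0$ put $a(\alpha,x)=p(\alpha,x)/q(\alpha)\in R_\alpha$. For a matrix $A=(a_{ij}(u,x))$ over $R$ put $A_\alpha=(a_{ij}(\alpha,x))$; this is defined for almost all $\alpha$. The specialization $F_\alpha$ of a free $R$-module $F$ of finite rank is a free $R_\alpha$-module of the same rank. With bases fixed, the specialization $\phi_\alpha:F_\alpha\to G_\alpha$ of a homomorphism $\phi:F\to G$ of free $R$-modules of finite ranks with matrix $A$ is the homomorphism with matrix $A_\alpha$. Each finitely generated $R$-module $L$ is considered together with a fixed (arbitrary) finite free presentation $F_1\xrightarrow{\phi}F_0\to L\to 0$ (free modules of finite ranks), and its specialization is $L_\alpha:=\operatorname{Coker}\phi_\alpha$. For an ideal $I$ of $R$, the specialization $I_\alpha$ is the ideal of $R_\alpha$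 generated by $\{f(\alpha,x)\mid f(u,x)\in I\cap k[u,x]\}$. For a module $L$ and an ideal $I$, $0_L:I=\{y\in L\mid Iy=0\}$. *)

(* Defs.v *)
From HB Require Import structures.
From mathcomp Require Import all_boot all_order all_algebra.
From mathcomp Require Import boolp classical_sets cardinality.
From mathcomp Require Import mpoly.

Set Implicit Arguments.
Unset Strict Implicit.
Unset Printing Implicit Defensive.

Import GRing.Theory.
Local Open Scope ring_scope.
Local Open Scope quotient_scope.

Section Modules.
Variables (R : comNzRingType) (M : lmodType R).

Record submodule : Type := Submodule {
  submodule_pred :> {pred M};
  submodule_closed : submod_closed submodule_pred
}.

HB.instance Definition _ (N : submodule) :=
  GRing.isSubmodClosed.Build R M (submodule_pred N) (submodule_closed N).

Record submod (N : submodule) : Type :=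
  Submod { submod_val : M; submod_valP : submod_val \in N }.

HB.instance Definition _ N := [isSub for @submod_val N].
HB.instance Definition _ N := [Choice of submod N by <:].
HB.instance Definition _ N := [SubChoice_isSubLmodule of submod N by <:].

Definition quotmod (N : submodule) : Type := Quotient.quot (submodule_pred N).

Section Quotmod.
Variable N : submodule.

HB.instance Definition _ := GRing.Zmodule.on (quotmod N).
HB.instance Definition _ := Quotient.on (quotmod N).

Definition quotmod_scale (a : R) (x : quotmod N) : quotmod N :=
  \pi_(quotmod N) (a *: repr x).

Lemma quotmod_piP (x y : M) :
  (\pi_(quotmod N) x = \pi_(quotmod N) y) <-> x - y \in N.
Proof. by rewrite Quotient.idealrBE; split=> [->|/eqP]. Qed.

Lemma quotmod_pi_scale a (x : M) :
  quotmod_scale a (\pi_(quotmod N) x) = \pi_(quotmod N) (a *: x).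
Proof.
by apply/quotmod_piP; rewrite -scalerBr rpredZ //; apply/quotmod_piP; rewrite reprK.
Qed.

Lemma quotmod_pi_add (x y : M) :
  \pi_(quotmod N) (x + y) = \pi_(quotmod N) x + \pi_(quotmod N) y :> quotmod N.
Proof. exact: Quotient.pi_add. Qed.

Fact quotmod_scaleA a b (x : quotmod N) :
  quotmod_scale a (quotmod_scale b x) = quotmod_scale (a * b) x.
Proof.
rewrite -[x]reprK; move: (repr x) => {}x.
by rewrite (quotmod_pi_scale b) !quotmod_pi_scale scalerA.
Qed.

Fact quotmod_scale1 : left_id 1 quotmod_scale.
Proof.
move=> x; rewrite -[x]reprK; move: (repr x) => {}x.
by rewrite quotmod_pi_scale scale1r.
Qed.

Fact quotmod_scaleDr : right_distributive quotmod_scale +%R.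
Proof.
move=> a x y; rewrite -[x]reprK -[y]reprK; move: (repr x) (repr y) => {}x {}y.
by rewrite -quotmod_pi_add !quotmod_pi_scale scalerDr quotmod_pi_add.
Qed.

Fact quotmod_scaleDl (x : quotmod N) :
  {morph quotmod_scale^~ x : a b / a + b >-> a + b}.
Proof.
move=> a b; rewrite -[x]reprK; move: (repr x) => {}x.
by rewrite !quotmod_pi_scale scalerDl quotmod_pi_add.
Qed.

HB.instance Definition _ := GRing.Zmodule_isLmodule.Build R (quotmod N)
  quotmod_scaleA quotmod_scale1 quotmod_scaleDr quotmod_scaleDl.

End Quotmod.
End Modules.

Definition lmod_iso (R : comNzRingType) (M N : lmodType R) : Prop :=
  exists f : {linear M -> N}, bijective f.

Section Coker.
Variables (R : comNzRingType) (s r : nat) (A : 'M[R]_(s, r)).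

(* A presents the map R^s -> R^r, v |-> v *m A (free modules are made of row
   vectors). *)
Definition rowimage : {pred 'rV[R]_r} :=
  fun v => `[< exists w : 'rV[R]_s, v = w *m A >].

Fact rowimage_closed : submod_closed rowimage.
Proof.
split; first by apply/asboolP; exists 0; rewrite mul0mx.
move=> a u v /asboolP[x ->] /asboolP[y ->]; apply/asboolP; exists (a *: x + y).
by rewrite mulmxDl scalemxAl.
Qed.

Definition coker : Type := quotmod (Submodule rowimage_closed).

HB.instance Definition _ :=
  GRing.Lmodule.copy coker (quotmod (Submodule rowimage_closed)).

End Coker.

Record presentation (R : comNzRingType) (L : lmodType R) := Presentation {
  nrel : nat;
  ngen : nat;
  pmx : 'M[R]_(nrel, ngen);
  paug : {linear 'rV[R]_ngen -> L};
  paug_surj : forall y : L, exists v, paug v = y;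
  paug_exact : forall v, paug v = 0 <-> v \in rowimage pmx
}.

Record is_ideal (R : comNzRingType) (I : R -> Prop) : Prop := IsIdeal {
  ideal0 : I 0;
  idealD : forall a b, I a -> I b -> I (a + b);
  idealM : forall a b, I b -> I (a * b)
}.

Definition ideal_generated_by (R : comNzRingType) (S : R -> Prop) : R -> Prop :=
  fun a => forall J : R -> Prop,
    is_ideal J -> (forall b, S b -> J b) -> J a.

Section IdealModule.
Variables (R : comNzRingType) (M : lmodType R) (I : R -> Prop).

Definition ann_pred : {pred M} :=
  fun y => `[< forall a, I a -> a *: y = 0 >].

Fact ann_closed : submod_closed ann_pred.
Proof.
split; first by apply/asboolP => a _; rewrite scaler0.
move=> b u v /asboolP hu /asboolP hv; apply/asboolP => a Ia.
by rewrite scalerDr scalerA mulrC -scalerA hu // hv // scaler0 addr0.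
Qed.

(* 0_M : I, as an R-module *)
Definition ann_mod : Type := submod (Submodule ann_closed).
HB.instance Definition _ :=
  GRing.Lmodule.copy ann_mod (submod (Submodule ann_closed)).

Definition ideal_mul_pred : {pred M} :=
  fun y => `[< exists2 l : seq (R * M), {in l, forall c, I c.1} &
                 y = \sum_(c <- l) c.1 *: c.2 >].

Fact ideal_mul_closed : submod_closed ideal_mul_pred.
Proof.
split; first by apply/asboolP; exists [::]; rewrite ?big_nil.
move=> b u v /asboolP[l hl ->] /asboolP[l' hl' ->]; apply/asboolP.
exists ([seq (c.1, b *: c.2) | c <- l] ++ l').
  by move=> c; rewrite mem_cat => /orP[/mapP[d /hl hd ->]|/hl'].
rewrite big_cat big_map scaler_sumr; congr (_ + _); apply: eq_bigr => c _.
by rewrite !scalerA mulrC.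
Qed.

(* IM, as an R-module *)
Definition ideal_mul_mod : Type := submod (Submodule ideal_mul_closed).
HB.instance Definition _ :=
  GRing.Lmodule.copy ideal_mul_mod (submod (Submodule ideal_mul_closed)).

End IdealModule.

Arguments ann_mod {R} M I.
Arguments ideal_mul_mod {R} M I.

Section Adjoin.
Variables (k K : fieldType) (iota : {rmorphism k -> K}) (m : nat).
Variable alpha : 'I_m -> K.

Definition adjoin_pred : {pred K} :=
  fun z => `[< exists p q : {mpoly k[m]},
     mmap iota alpha q != 0 /\ z = mmap iota alpha p / mmap iota alpha q >].

Fact adjoin_closed : divring_closed adjoin_pred.
Proof.
split.
- by apply/asboolP; exists 1, 1; rewrite rmorph1 oner_eq0 divr1.
- move=> x y /asboolP[p [q [q0 ->]]] /asboolP[p' [q' [q'0 ->]]].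
  apply/asboolP; exists (p * q' - p' * q), (q * q').
  rewrite !rmorphB !rmorphM mulf_neq0 //; split=> //.
  by rewrite -[in LHS]mulNr addf_div // mulNr.
- move=> x y /asboolP[p [q [q0 ->]]] /asboolP[p' [q' [q'0 ->]]].
  apply/asboolP; have [p'0|p'0] := eqVneq (mmap iota alpha p') 0.
    by exists 0, 1; rewrite rmorph1 oner_eq0 rmorph0 p'0 mul0r invr0 mulr0 mul0r.
  exists (p * q'), (q * p'); rewrite !rmorphM mulf_neq0 //; split=> //.
  by rewrite invf_div mulf_div.
Qed.

HB.instance Definition _ :=
  GRing.isDivringClosed.Build K adjoin_pred adjoin_closed.

Record adjoin : Type :=
  Adjoin { adjoin_val : K; adjoin_valP : adjoin_val \in adjoin_pred }.

HB.instance Definition _ := [isSub for adjoin_val].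
HB.instance Definition _ := [Choice of adjoin by <:].
HB.instance Definition _ := [SubChoice_isSubComUnitRing of adjoin by <:].
HB.instance Definition _ := [SubComUnitRing_isSubIntegralDomain of adjoin by <:].
HB.instance Definition _ := [SubIntegralDomain_isSubField of adjoin by <:].

Fact adjoin_eval_subproof (p : {mpoly k[m]}) :
  mmap iota alpha p \in adjoin_pred.
Proof.
by apply/asboolP; exists p, 1; rewrite rmorph1 oner_eq0 divr1.
Qed.

(* p(u) |-> p(alpha), as an element of k(alpha) *)
Definition eval_at (p : {mpoly k[m]}) : adjoin :=
  Sub (mmap iota alpha p) (adjoin_eval_subproof p).

Fact eval_at_zmod_morphism : zmod_morphism eval_at.
Proof. by move=> p q; apply: val_inj; rewrite /= rmorphB. Qed.
Fact eval_at_monoid_morphism : monoid_morphism eval_at.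
Proof. by split=> [|p q]; apply: val_inj; rewrite /= ?rmorph1 ?rmorphM. Qed.

HB.instance Definition _ :=
  GRing.isZmodMorphism.Build _ _ eval_at eval_at_zmod_morphism.
HB.instance Definition _ :=
  GRing.isMonoidMorphism.Build _ _ eval_at eval_at_monoid_morphism.

End Adjoin.

Fact scalerV_cross (F : fieldType) (V : lmodType F) (a b : F) (x y : V) :
  a != 0 -> b != 0 -> a *: x = b *: y -> b^-1 *: x = a^-1 *: y.
Proof.
by move=> a0 b0 e; rewrite -[x](scalerK a0) e !scalerA mulrAC mulVf // mul1r.
Qed.

Section Specialization.
Variables (k K : fieldType) (iota : {rmorphism k -> K}) (m n : nat).

(* k[u,x] is represented as k[u][x]. *)
Local Notation kux := {mpoly {mpoly k[m]}[n]}.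
Local Notation R := {mpoly {fraction {mpoly k[m]}}[n]}.

Definition kux_incl (p : kux) : R := map_mpoly (@FracField.tofrac _) p.

Variable alpha : 'I_m -> K.
Local Notation R_alpha := {mpoly (adjoin iota alpha)[n]}.

Definition spec_poly (p : kux) : R_alpha := map_mpoly (eval_at iota alpha) p.

(* a = p/q with p in k[u,x], q in k[u] and q(alpha) <> 0; by specE below, the
   value p(alpha,x)/q(alpha) does not depend on the choice of (p, q) *)
Definition spec_fraction (a : R) (pq : kux * {mpoly k[m]}) : Prop :=
  eval_at iota alpha pq.2 != 0 /\
  a = (FracField.tofrac pq.2)^-1 *: kux_incl pq.1.

Definition specializable (a : R) : Prop := exists pq, spec_fraction a pq.

(* a(alpha,x), with junk value 0 when a is not specializable at alpha *)
Definition spec (a : R) : R_alpha :=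
  match pselect (specializable a) with
  | left h => let pq := projT1 (cid h) in
              (eval_at iota alpha pq.2)^-1 *: spec_poly pq.1
  | right _ => 0
  end.

Lemma specE a p q : spec_fraction a (p, q) ->
  spec a = (eval_at iota alpha q)^-1 *: spec_poly p.
Proof.
rewrite /spec => h; case: pselect => [h'|[]]; last by exists (p, q).
case: cid => -[p' q'] [/= q'a ea] /=; case: h => /= qa ea'.
have q0 : q != 0 by apply: contra_neq qa => ->; rewrite rmorph0.
have q'0 : q' != 0 by apply: contra_neq q'a => ->; rewrite rmorph0.
have F0 (x : {mpoly k[m]}) : x != 0 -> FracField.tofrac x != 0.
  by move=> ?; rewrite tofrac_eq0.
have e : q *: p' = q' *: p.
  have inj : injective kux_incl.
    move=> x y /mpolyP exy; apply/mpolyP => mm; have := exy mm.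
    rewrite [LHS]mcoeff_map_mpoly [RHS]mcoeff_map_mpoly => /eqP.
    by rewrite tofrac_eq => /eqP.
  have ep : kux_incl p = FracField.tofrac q *: a by rewrite ea' scalerKV ?F0.
  have ep' : kux_incl p' = FracField.tofrac q' *: a by rewrite ea scalerKV ?F0.
  apply: inj; rewrite [LHS]map_mpolyZ [RHS]map_mpolyZ.
  by rewrite -/(kux_incl p) -/(kux_incl p') ep ep' !scalerA mulrC.
apply: (scalerV_cross qa q'a).
by rewrite -[LHS]map_mpolyZ -[RHS]map_mpolyZ e.
Qed.

Definition specializable_mx s r (A : 'M[R]_(s, r)) : Prop :=
  forall i j, specializable (A i j).

Definition spec_mx s r (A : 'M[R]_(s, r)) : 'M[R_alpha]_(s, r) := map_mx spec A.

(* L_alpha; it depends on the presentation of L, as in the definition *)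
Definition spec_mod (L : lmodType R) (P : presentation L) : Type :=
  coker (spec_mx (pmx P)).
HB.instance Definition _ L (P : presentation L) :=
  GRing.Lmodule.copy (spec_mod P) (coker (spec_mx (pmx P))).

Definition spec_ideal (I : R -> Prop) : R_alpha -> Prop :=
  ideal_generated_by (fun b => exists2 f : kux, I (kux_incl f) & b = spec_poly f).

End Specialization.

Arguments spec_ideal {k K} iota {m n} alpha I.

Definition zero_locus (K : fieldType) (m : nat) (S : {mpoly K[m]} -> Prop)
  (alpha : 'I_m -> K) : Prop := forall f, S f -> f.@[alpha] = 0.

(* a proper subvariety of K^m is a zero locus of polynomials over K that is not
   all of K^m *)
Definition almost_all (K : fieldType) (m : nat) (P : ('I_m -> K) -> Prop) : Prop :=
  exists2 S : {mpoly K[m]} -> Prop,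
    exists alpha, ~ zero_locus S alpha &
    forall alpha, ~ zero_locus S alpha -> P alpha.

(* Main.v *)
(* Everything reduces to one fact: if the rows of B generate the relations
   between the rows of a matrix A over k[u,x], then for almost all alpha the rows
   of B_alpha generate the relations between the rows of A_alpha.  By Dickson's
   lemma the leading positions of the elements of the row space of A are the
   multiples of finitely many of them; as soon as alpha does not annihilate the
   corresponding leading coefficients in k[u], leading terms can still be
   reduced after specialization and no new relation appears.  Hence preimages,
   sums, intersections, and therefore colons and products by finitely many
   polynomials, commute with specialization for almost all alpha.  As k[u,x] is
   noetherian, finitely many elements generate the contraction of I to k[u,x],
   and their specializations generate every I_alpha. *)
Require Import Defs.
From HB Require Import structures.
From mathcomp Require Import all_boot all_order all_algebra.
From mathcomp Require Import boolp classical_sets cardinality.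
From mathcomp Require Import mpoly.

Set Implicit Arguments.
Unset Strict Implicit.
Unset Printing Implicit Defensive.

Import Order.TTheory GRing.Theory.
Local Open Scope ring_scope.
Local Open Scope quotient_scope.

(** * Dickson's lemma *)

(** Each term may be constrained by all earlier ones; this is how a failure of finite generation
    becomes an infinite sequence. *)
Lemma dependent_choice (T : eqType) (P : T -> Prop) (Q : seq T -> T -> Prop) :
  (forall l, (forall x, x \in l -> P x) -> exists v, P v /\ Q l v) ->
  exists f : nat -> T, forall j, P (f j) /\ Q (mkseq f j) (f j).
Proof.
move=> step.
have /choice[pick pickP] l :
    exists v, (forall x, x \in l -> P x) -> P v /\ Q l v.
  have [h|h] := pselect (forall x, x \in l -> P x).
    by have [v hv] := step l h; exists v.
  (* A list violating [P] gets an arbitrary value, taken from the empty list; no [F j] is such a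
     list. *)
  by have [|v _] := step [::]; last by exists v.
pose F j := iter j (fun l => rcons l (pick l)) [::].
have FE j : mkseq (fun i => pick (F i)) j = F j.
  by elim: j => //= j IHj; rewrite mkseqS IHj.
have PF j x : x \in F j -> P x.
  elim: j x => //= j IHj x; rewrite mem_rcons inE => /orP[/eqP ->|/IHj //].
  exact: (pickP _ IHj).1.
by exists (fun j => pick (F j)) => j; rewrite FE; apply: pickP; apply: PF.
Qed.

(** For each [N] some index attains the least value of [f] over the indices at least [N]; the
    subsequence repeatedly jumps to such an index. *)
Lemma nondecreasing_subsequence (f : nat -> nat) :
  exists2 g : nat -> nat, {homo g : i j / (i < j)%N} &
    {homo (f \o g) : i j / (i <= j)%N}.
Proof.
have /choice[h hP] N :
    exists i, (N <= i)%N /\ forall j, (N <= j)%N -> (f i <= f j)%N.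
  pose P y := `[< exists2 i, (N <= i)%N & f i = y >].
  have exP : exists y, P y by exists (f N); apply/asboolP; exists N.
  case: (ex_minnP exP) => _ /asboolP[i Ni <-] fmin; exists i; split=> // j Nj.
  by apply: fmin; apply/asboolP; exists j.
pose g := fix g j := if j is j'.+1 then h (g j').+1 else h 0%N.
have gS i : (g i < g i.+1)%N by exact: (hP _).1.
have gmono : {homo g : i j / (i < j)%N} by apply: homo_ltn gS; apply: ltn_trans.
exists g => //; apply: homo_leq => [//|? ? ?|i /=]; first exact: leq_trans.
have -> : g i = h (if i is i'.+1 then (g i').+1 else 0%N) by case: i.
by apply: (hP _).2; case: i => // i; apply: leq_trans (gS _) (ltnW (gS _)).
Qed.

Lemma nondecreasing_subsequences (F : nat -> nat -> nat) (t : nat) :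
  exists2 g : nat -> nat, {homo g : i j / (i < j)%N} &
    forall s, (s < t)%N -> {homo (F s \o g) : i j / (i <= j)%N}.
Proof.
elim: t => [|t [g gmono gF]]; first by exists id.
have [h hmono hF] := nondecreasing_subsequence (F t \o g).
exists (g \o h) => [i j ij|s]; first exact/gmono/hmono.
rewrite ltnS leq_eqVlt => /orP[/eqP ->|st]; first exact: hF.
move=> i j; rewrite leq_eqVlt => /orP[/eqP -> //|/hmono/ltnW hij].
exact: gF.
Qed.

(* (m, i) is the place of the monomial x^m in the i-th component of a vector. *)
Notation position n r := ('X_{1..n} *l 'I_r)%type.

Definition divides_at n r (e e' : position n r) : bool :=
  (e.2 == e'.2) && (e.1 <= e'.1)%MM.

(* The component of a position is frozen along a subsequence
   by making both it and its complement nondecreasing. *)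
Lemma dickson n r (e : nat -> position n r) :
  exists2 g : nat -> nat, {homo g : i j / (i < j)%N} &
    forall i j, (i <= j)%N -> divides_at (e (g i)) (e (g j)).
Proof.
pose F s i := if insub s is Some s' then (e i).1 s' else
              if s == n then (e i).2 : nat else (r - (e i).2)%N.
have [g gmono gF] := nondecreasing_subsequences F n.+2.
exists g => // i j ij; apply/andP; split.
  have := gF n (leqnSn _) i j ij; have := gF n.+1 (leqnn _) i j ij.
  rewrite /= /F !insubF ?ltnn // ?eqxx ?ltnNge ?leqnSn //.
  rewrite gtn_eqF // => h1 h2.
  rewrite eq_le; apply/andP; split; first exact: h2.
  rewrite leEord -[leqLHS](subKn (ltnW (ltn_ord _))).
  by rewrite -[leqRHS](subKn (ltnW (ltn_ord _))) leq_sub2l.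
apply/mnm_lepP => s; have := gF s (leqW (leqW (ltn_ord s))) i j ij.
by rewrite /= /F valK.
Qed.

(** The order is lexicographic with the monomial first, so an induction on the monomial contains one
    on the component. *)
Lemma position_wf n r : well_founded (fun e e' : position n r => (e < e')%O).
Proof.
case=> m i.
elim/(well_founded_induction (@ltom_wf n)): m i => m IHm i.
have [N] := ubnP (nat_of_ord i).
elim: N i => [i|N IHN i iN]; first by rewrite ltn0.
constructor=> -[m' i']; rewrite ltEprodlexi /= => /andP[mm' h].
have [e|ne] := eqVneq m' m; last by apply: IHm; rewrite lt_neqAle ne.
move: h; rewrite e lexx /= ltEord => h; apply: IHN.
exact: leq_trans h iN.
Qed.

(** * Leading positions and noetherianity *)

Lemma seq_max d (T : orderType d) (x0 : T) (s : seq T) : x0 \in s ->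
  exists2 x, x \in s & forall y, y \in s -> (y <= x)%O.
Proof.
elim: s x0 => // a s IHs x0 _; case: s IHs => [_|b s IHs].
  by exists a; rewrite ?mem_head // => y; rewrite mem_seq1 => /eqP ->.
have [//|x xs xmax] := IHs b; first exact: mem_head.
exists (Order.max a x).
  by rewrite /Order.max; case: ifP => _; rewrite ?mem_head // inE xs orbT.
move=> y; rewrite inE le_max => /orP[/eqP ->|/xmax ->]; first by rewrite lexx.
by rewrite orbT.
Qed.

Section Lead.
Variables (A : comNzRingType) (n r : nat).
Implicit Types (v : 'rV[{mpoly A[n]}]_r) (e : position n r) (m : 'X_{1..n}).

Definition vcoef v e : A := (v 0 e.2)@_(e.1).

Lemma vcoefB u v e : vcoef (u - v) e = vcoef u e - vcoef v e.
Proof. by rewrite /vcoef !mxE mcoeffB. Qed.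

Lemma vcoef_sum (J : Type) (s : seq J) (F : J -> 'rV[{mpoly A[n]}]_r) e :
  vcoef (\sum_(j <- s) F j) e = \sum_(j <- s) vcoef (F j) e.
Proof. by rewrite /vcoef summxE raddf_sum. Qed.

Lemma vcoefC a v e : vcoef (a%:MP *: v) e = a * vcoef v e.
Proof. by rewrite /vcoef mxE mcoeffCM. Qed.

Definition shift m e : position n r := ((m + e.1)%MM, e.2).

Lemma vcoef_shift m v e : vcoef ('X_[m] *: v) (shift m e) = vcoef v e.
Proof. by rewrite /vcoef mxE mulrC mcoeffMX. Qed.

Lemma vcoef_shift_eq0 m v e : ~~ (m <= e.1)%MM -> vcoef ('X_[m] *: v) e = 0.
Proof.
move=> me; rewrite /vcoef mxE mulrC; apply: memN_msupp_eq0.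
rewrite (perm_mem (msuppMX _ _)); apply: contra me => /mapP[m' _ ->].
exact: lem_addr.
Qed.

Lemma lt_shift m e e' : (shift m e < shift m e')%O = (e < e')%O.
Proof. by rewrite !ltEprodlexi /= !lemc_add2r. Qed.

Lemma shiftK m e : (m <= e.1)%MM -> shift m ((e.1 - m)%MM, e.2) = e.
Proof. by case: e => m' i /= h; rewrite /shift /= addmC submK. Qed.

Definition lead v e : Prop :=
  vcoef v e != 0 /\ forall e', (e < e')%O -> vcoef v e' = 0.

Lemma vcoef_ext u v : vcoef u =1 vcoef v -> u = v.
Proof. by move=> h; apply/rowP => i; apply/mpolyP => m; apply: (h (m, i)). Qed.

Lemma lead_exists v : v != 0 -> exists e, lead v e.
Proof.
move=> v0; pose s : seq (position n r) :=
  [seq (m, i) | i <- enum 'I_r, m <- msupp (v 0 i)].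
have sP e : (e \in s) = (vcoef v e != 0).
  rewrite /vcoef -mcoeff_msupp.
  apply/allpairsPdep/idP => [[i [m [_ h ->]]] //|h].
  by exists e.2, e.1; rewrite mem_enum h -surjective_pairing.
case: (pselect (exists e, e \in s)) => [[e0 e0s]|none].
  have [e es emax] := seq_max e0s.
  exists e; split=> [|e' lt_ee']; first by rewrite -sP.
  by apply: contraTeq lt_ee'; rewrite -sP -leNgt; apply: emax.
case/eqP: v0; apply: vcoef_ext => e; rewrite [RHS]/vcoef mxE mcoeff0.
by apply: contra_notP none => /eqP h; exists e; rewrite sP.
Qed.

Lemma vcoef_shift_gt m v e e' : lead v e -> (shift m e < e')%O ->
  vcoef ('X_[m] *: v) e' = 0.
Proof.
move=> [_ hle]; have [me'|me' _] := boolP (m <= e'.1)%MM;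
  last exact: vcoef_shift_eq0.
by rewrite -(shiftK me') lt_shift vcoef_shift => /hle.
Qed.

Lemma lead_shift m v e : lead v e -> lead ('X_[m] *: v) (shift m e).
Proof.
move=> hl; split; first by rewrite vcoef_shift; case: hl.
by move=> e'; apply: vcoef_shift_gt.
Qed.

End Lead.

Definition is_submodule (A : comNzRingType) (M : lmodType A) (N : M -> Prop) :=
  N 0 /\ forall a u v, N u -> N v -> N (a *: u + v).

Definition spanned (A : comNzRingType) (M : lmodType A) (l : seq M) (v : M) :=
  forall N, is_submodule N -> (forall x, x \in l -> N x) -> N v.

(** A form of the ascending chain condition: some term lies in the ideal generated by its
    predecessors. At [j = 0] the sum is empty. *)
Definition noetherian (A : comNzRingType) : Prop :=
  forall c : nat -> A, exists j, exists a : nat -> A,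
    c j = \sum_(i < j) a i * c i.

Section Submodule.
Variables (A : comNzRingType) (M : lmodType A) (N : M -> Prop).
Hypothesis hN : is_submodule N.

Lemma submodule0 : N 0. Proof. by case: hN. Qed.
Lemma submoduleZ a v : N v -> N (a *: v).
Proof. by move=> Nv; have := hN.2 a v 0 Nv hN.1; rewrite addr0. Qed.
Lemma submoduleD u v : N u -> N v -> N (u + v).
Proof. by move=> Nu Nv; have := hN.2 1 u v Nu Nv; rewrite scale1r. Qed.
Lemma submoduleN v : N v -> N (- v).
Proof. by move=> Nv; rewrite -scaleN1r; apply: submoduleZ. Qed.
Lemma submoduleB u v : N u -> N v -> N (u - v).
Proof. by move=> Nu Nv; apply: submoduleD => //; apply: submoduleN. Qed.
Lemma submodule_sum (J : eqType) (s : seq J) (F : J -> M) :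
  (forall j, j \in s -> N (F j)) -> N (\sum_(j <- s) F j).
Proof.
move=> h; rewrite big_seq; elim/big_ind: _ => //; first exact: submodule0.
exact: submoduleD.
Qed.
End Submodule.

Lemma spanned_submodule (A : comNzRingType) (M : lmodType A) (l : seq M) :
  is_submodule (spanned l).
Proof.
split=> [N hN _|a u v hu hv N hN h]; first exact: submodule0.
by apply: hN.2; [apply: hu|apply: hv].
Qed.

(* A sequence of elements of N, each outside the span of the previous ones and
   with smallest possible leading position, has a subsequence whose leading
   positions divide each other; a relation between its leading coefficients
   then cancels a leading term, against minimality. *)
Theorem hilbert_basis (A : comNzRingType) (n r : nat)
    (N : 'rV[{mpoly A[n]}]_r -> Prop) :
  noetherian A -> is_submodule N ->
  exists l, (forall x, x \in l -> N x) /\ (forall v, N v -> spanned l v).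
Proof.
move=> nA hN; apply: contrapT => nofin.
pose T := ('rV[{mpoly A[n]}]_r * position n r)%type.
pose P (x : T) := N x.1 /\ lead x.1 x.2.
pose Q (l : seq T) (x : T) := ~ spanned (map fst l) x.1 /\
  forall v e, N v -> ~ spanned (map fst l) v -> lead v e -> (x.2 <= e)%O.
have [l Pl|f fP] := @dependent_choice T P Q.
  (* If no minimal choice existed, well-founded induction on leading positions would put all of [N]
     in the span of [l], against [nofin]. *)
  apply: contrapT => nomin.
  have none e : forall v, N v -> ~ spanned (map fst l) v -> ~ lead v e.
    elim/(well_founded_induction (@position_wf n r)): e => e IHe v Nv sv hl.
    apply: nomin; exists (v, e); split; first by split.
    split=> // v' e' Nv' sv' hl'; rewrite leNgt; apply/negP => lt_e'e.
    exact: IHe lt_e'e _ Nv' sv' hl'.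
  apply: nofin; exists (map fst l); split=> [_ /mapP[x /Pl[? _] ->] //|v Nv].
  apply: contrapT => sv; have [v0|/lead_exists[e]] := eqVneq v 0; last exact: none.
  by apply: sv; rewrite v0; apply: (spanned_submodule _).1.
have [g gmono gdiv] := dickson (fun j => (f j).2).
have [j [a ca]] := nA (fun j => vcoef (f (g j)).1 (f (g j)).2).
have [[Nj [lj0 lj]] [sj minj]] := fP (g j).
pose mm i := ((f (g j)).2.1 - (f (g i)).2.1)%MM.
have shiftE (i : 'I_j) : shift (mm i) (f (g i)).2 = (f (g j)).2.
  have /andP[/eqP h1 h2] := gdiv i j (ltnW (ltn_ord i)).
  by rewrite /shift /mm submK // h1 -surjective_pairing.
(* The monomials bring the earlier leading positions to that of [f (g j)], so [w] has the same
   coefficient there and none above. *)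
pose w := \sum_(i <- index_enum 'I_j) (a i)%:MP *: ('X_[mm i] *: (f (g i)).1).
have sw : spanned (map fst (mkseq f (g j))) w.
  apply: (submodule_sum (spanned_submodule _)) => i _.
  do 2!apply: (submoduleZ (spanned_submodule _)) => //.
  move=> N' _; apply; apply: map_f; apply/mapP; exists (g i) => //.
  by rewrite mem_iota add0n /=; apply: gmono.
have Nw : N w.
  apply: submodule_sum => // i _; do 2!apply: submoduleZ => //.
  exact: (fP _).1.1.
have sub_nspan : ~ spanned (map fst (mkseq f (g j))) ((f (g j)).1 - w).
  move=> h; apply: sj; rewrite -[_.1](subrK w).
  exact: (submoduleD (spanned_submodule _)).
have [|e le] := @lead_exists _ _ _ ((f (g j)).1 - w).
  apply: contra_notN sub_nspan => /eqP ->; exact: (spanned_submodule _).1.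
have := minj _ _ (submoduleB hN Nj Nw) sub_nspan le; rewrite le_eqVlt.
case: le => /[swap] _ /[swap] /orP[/eqP <-|lt_e].
  rewrite vcoefB vcoef_sum ca -sumrB big1 ?eqxx // => i _.
  by rewrite vcoefC -(shiftE i) vcoef_shift subrr.
rewrite vcoefB vcoef_sum lj // big1 ?subrr ?eqxx // => i _.
rewrite vcoefC (vcoef_shift_gt (e := (f (g i)).2)) ?mulr0 ?shiftE //.
exact: (fP _).1.2.
Qed.

Definition rowspan (A : comNzRingType) t r (B : 'M[A]_(t, r)) (v : 'rV[A]_r) :=
  exists w : 'rV[A]_t, v = w *m B.

Lemma rowspan_submodule (A : comNzRingType) t r (B : 'M[A]_(t, r)) :
  is_submodule (rowspan B).
Proof.
split; first by exists 0; rewrite mul0mx.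
by move=> a u v [x ->] [y ->]; exists (a *: x + y); rewrite mulmxDl scalemxAl.
Qed.

Lemma rowspan_row (A : comNzRingType) t r (B : 'M[A]_(t, r)) i :
  rowspan B (row i B).
Proof. by exists (delta_mx 0 i); rewrite rowE. Qed.

Lemma rowspan_min (A : comNzRingType) t r (B : 'M[A]_(t, r)) N :
  is_submodule N -> (forall i, N (row i B)) -> forall v, rowspan B v -> N v.
Proof.
move=> hN hB _ [w ->]; rewrite mulmx_sum_row; apply: submodule_sum => // i _.
exact: submoduleZ.
Qed.

Lemma finitely_generated (A : comNzRingType) n r
    (N : 'rV[{mpoly A[n]}]_r -> Prop) :
  noetherian A -> is_submodule N ->
  exists t, exists B : 'M[{mpoly A[n]}]_(t, r), forall v, N v <-> rowspan B v.
Proof.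
move=> nA hN; have [l [lN Nl]] := hilbert_basis nA hN.
exists (size l), (\matrix_(i < size l) nth 0 l i) => v; split.
  move=> /Nl; apply=> [|x xl]; first exact: rowspan_submodule.
  have xi : (index x l < size l)%N by rewrite index_mem.
  set B := \matrix_(i < _) _; suff -> : x = row (Ordinal xi) B by exact: rowspan_row.
  by rewrite rowK /= nth_index.
by apply: rowspan_min => // i; rewrite rowK; apply/lN/mem_nth.
Qed.

(** Either the first term is zero, the empty sum, or it divides the second. *)
Lemma noetherian_field (F : fieldType) : noetherian F.
Proof.
move=> c; have [c0|c0] := eqVneq (c 0%N) 0.
  by exists 0%N, (fun=> 0); rewrite big_ord0.
by exists 1%N, (fun=> c 1%N / c 0%N); rewrite big_ord1 divfK.
Qed.

Lemma spanned_mkseq (A : comNzRingType) (M : lmodType A) (f : nat -> M) j v :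
  spanned (mkseq f j) v -> exists a : nat -> A, v = \sum_(i < j) a i *: f i.
Proof.
move=> hv; apply: (hv (fun v => exists a : nat -> A, v = \sum_(i < j) a i *: f i)).
  split; first by exists (fun=> 0); rewrite big1 // => i _; rewrite scale0r.
  move=> b u w [a ->] [a' ->]; exists (fun i => b * a i + a' i).
  rewrite scaler_sumr -big_split; apply: eq_bigr => i _.
  by rewrite scalerDl scalerA.
move=> _ /mapP[i + ->]; rewrite mem_iota add0n => /= ij.
exists (fun i' => (i' == i)%:R).
rewrite (bigD1 (Ordinal ij)) //= eqxx scale1r big1 ?addr0 // => i' ne.
by rewrite (negPf (ne : (i' : nat) != i)) scale0r.
Qed.

(** The spans of the initial segments of [c] form a chain, and [hilbert_basis] gives finitely many
    generators of their union. These already lie in the span of one segment, which then contains the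
    next term. *)
Lemma noetherian_mpoly (A : comNzRingType) n :
  noetherian A -> noetherian {mpoly A[n]}.
Proof.
move=> nA c; pose f i : 'rV[{mpoly A[n]}]_1 := const_mx (c i).
have mono i j v : (i <= j)%N -> spanned (mkseq f i) v -> spanned (mkseq f j) v.
  move=> ij; apply; first exact: spanned_submodule.
  move=> _ /mapP[s si ->] N _; apply; apply: map_f; move: si.
  by rewrite !mem_iota !add0n => /= /leq_trans; apply.
pose N v := exists j, spanned (mkseq f j) v.
have hN : is_submodule N.
  split; first by exists 0%N; apply: (spanned_submodule _).1.
  move=> a u v [i hu] [j hv]; exists (maxn i j).
  by apply: (spanned_submodule _).2; [move: hu|move: hv]; apply: mono;
     rewrite ?leq_maxl ?leq_maxr.
have [l [lN Nl]] := hilbert_basis nA hN.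
have [J hJ] : exists J, forall x, x \in l -> spanned (mkseq f J) x.
  elim: l lN {Nl} => [|x l IHl] lN; first by exists 0%N.
  have [|J hJ] := IHl; first by move=> y yl; apply: lN; rewrite inE yl orbT.
  have [i hi] := lN x (mem_head _ _); exists (maxn i J) => y.
  by rewrite inE => /orP[/eqP ->|/hJ]; [move: hi|]; apply: mono;
     rewrite ?leq_maxl ?leq_maxr.
have NfJ : N (f J).
  exists J.+1 => N' _; apply; apply/mapP; exists J => //.
  by rewrite mem_iota add0n /=.
have [a fa] := spanned_mkseq (Nl _ NfJ _ (spanned_submodule _) hJ).
exists J, a; have := congr1 (fun v : 'rV_1 => v 0 0) fa.
by rewrite mxE summxE => ->; apply: eq_bigr => i _; rewrite !mxE.
Qed.

(** * Specialization of relations *)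

Lemma map_mpoly_mxC (A B : comNzRingType) (f : {rmorphism A -> B}) n s r a
    (M : 'M[{mpoly A[n]}]_(s, r)) :
  map_mx (map_mpoly f) (a%:MP *: M) = (f a)%:MP *: map_mx (map_mpoly f) M.
Proof. by apply/matrixP => i j; rewrite !mxE rmorphM /= map_mpolyC. Qed.

Section Kernel.
Variables (D : idomainType) (n p q : nat) (A : 'M[{mpoly D[n]}]_(p, q)).

(** Otherwise there is a sequence of leading positions in the row space of [A], none divisible by an
    earlier one, which [dickson] forbids. *)
Lemma lead_generators :
  exists l : seq ('rV[{mpoly D[n]}]_p * position n q),
    (forall x, x \in l -> lead (x.1 *m A) x.2) /\
    forall h e, lead (h *m A) e -> exists2 x, x \in l & divides_at x.2 e.
Proof.
apply: contrapT => none.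
pose T := ('rV[{mpoly D[n]}]_p * position n q)%type.
have [l Pl|f fP] := @dependent_choice T (fun x => lead (x.1 *m A) x.2)
    (fun l x => forall y, y \in l -> ~~ divides_at y.2 x.2).
  apply: contrapT => nox; apply: none; exists l; split=> // h e he.
  apply: contrapT => nodiv; apply: nox; exists (h, e); split=> // y yl.
  by apply: contra_notN nodiv => div; exists y.
have [g gmono gdiv] := dickson (fun j => (f j).2).
have f0 : f (g 0%N) \in mkseq f (g 1%N).
  by apply: map_f; rewrite mem_iota add0n /=; apply: gmono.
by have := (fP (g 1%N)).2 _ f0; rewrite gdiv.
Qed.

Definition leads_survive (k' : fieldType) (phi : {rmorphism D -> k'}) : Prop :=
  forall e, (exists h, lead (h *m A) e) ->
  exists c, lead (c *m A) e /\ phi (vcoef (c *m A) e) != 0.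

(** [d] is the product of the leading coefficients of the vectors from [lead_generators]. Every
    leading position is reached by multiplying one of these by a monomial, with the same leading
    coefficient. *)
Lemma generic_leads_survive :
  exists2 d : D, d != 0 & forall (k' : fieldType) (phi : {rmorphism D -> k'}),
    phi d != 0 -> leads_survive phi.
Proof.
have [l [ll lP]] := lead_generators.
exists (\prod_(x <- l) vcoef (x.1 *m A) x.2).
  by rewrite prodf_seq_neq0; apply/allP => x /ll[].
move=> k' phi; rewrite rmorph_prod prodf_seq_neq0 => /allP phil e [h he].
have [x xl /andP[/eqP e2 e1]] := lP h e he.
have eE : shift (e.1 - x.2.1)%MM x.2 = e.
  by rewrite /shift submK // e2 -surjective_pairing.
exists ('X_[e.1 - x.2.1] *: x.1); rewrite -scalemxAl; split.
  by rewrite -[in X in lead _ X]eE; apply/lead_shift/ll.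
by rewrite -[in X in vcoef _ X]eE vcoef_shift; apply: phil.
Qed.

Variables (k' : fieldType) (phi : {rmorphism D -> k'}).
Local Notation mapphi := (map_mx (map_mpoly phi)).

Lemma vcoef_map r (v : 'rV[{mpoly D[n]}]_r) e :
  vcoef (mapphi v) e = phi (vcoef v e).
Proof. by rewrite /vcoef mxE mcoeff_map_mpoly. Qed.

Lemma mapphiB r (u v : 'rV[{mpoly D[n]}]_r) :
  mapphi (u - v) = mapphi u - mapphi v.
Proof. by apply/rowP => i; rewrite !mxE rmorphB. Qed.

(* Let T be the k'-span of the specializations of elements c_e whose images have
   leading position e, one for each e.  Reducing leading terms shows that T and
   the specialized relations span everything, while A is injective on T because
   leading positions are preserved. *)
Theorem kernel_specialization l (B : 'M[{mpoly D[n]}]_(l, p)) :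
  leads_survive phi -> (forall v, v *m A = 0 <-> rowspan B v) ->
  forall h, h *m mapphi A = 0 -> rowspan (mapphi B) h.
Proof.
move=> surv kerB.
have /choice[c cP] e : exists c, (exists h, lead (h *m A) e) ->
    lead (c *m A) e /\ phi (vcoef (c *m A) e) != 0.
  have [he|ne] := pselect (exists h, lead (h *m A) e); last by exists 0.
  by have [c hc] := surv e he; exists c.
pose good e := lead (c e *m A) e /\ phi (vcoef (c e *m A) e) != 0.
pose tau (s : seq (k' * position n q)) :=
  \sum_(x <- s) x.1%:MP *: mapphi (c x.2).
pose U v := exists s, (forall x, x \in s -> good x.2) /\
  rowspan (mapphi B) (v - tau s).
have UD u v : U u -> U v -> U (u + v).
  move=> [s [gs hs]] [t [gt ht]]; exists (s ++ t); split.
    by move=> x; rewrite mem_cat => /orP[/gs|/gt].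
  rewrite /tau big_cat opprD addrACA.
  exact: (submoduleD (rowspan_submodule _)).
have UZ a v : U v -> U (a%:MP *: v).
  move=> [s [gs hs]]; exists [seq (a * x.1, x.2) | x <- s]; split.
    by move=> _ /mapP[x /gs ? ->].
  have -> : tau [seq (a * x.1, x.2) | x <- s] = a%:MP *: tau s.
    rewrite /tau big_map scaler_sumr; apply: eq_bigr => x _.
    by rewrite scalerA mpolyCM.
  rewrite -scalerBr; exact: (submoduleZ (rowspan_submodule _)).
have U0 v : rowspan (mapphi B) v -> U v.
  by move=> hv; exists [::]; rewrite /tau big_nil subr0.
have Uker h : h *m A = 0 -> U (mapphi h).
  by move=> /kerB[w ->]; apply: U0; exists (mapphi w); rewrite map_mxM.
have Ulead e : forall h, lead (h *m A) e -> U (mapphi h).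
  elim/(well_founded_induction (@position_wf n q)): e => e IHe h he.
  have [ce phice] := cP e (ex_intro _ h he).
  set a := vcoef (h *m A) e; set b := vcoef (c e *m A) e in phice.
  (* Leading terms are cancelled by cross-multiplication, since [b] need not be invertible in [D];
     [phi b] is invertible in [k']. *)
  pose h2 := b%:MP *: h - a%:MP *: c e.
  have vcoefh2 e' : vcoef (h2 *m A) e' =
      b * vcoef (h *m A) e' - a * vcoef (c e *m A) e'.
    by rewrite mulmxBl -!scalemxAl vcoefB !vcoefC.
  have Uh2 : U (mapphi h2).
    have [/Uker //|/lead_exists[e2 he2]] := eqVneq (h2 *m A) 0.
    apply: (IHe e2) => //; rewrite ltNge; apply: contraNN he2.1.
    rewrite vcoefh2 le_eqVlt => /orP[/eqP <-|lt_ee2].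
      by rewrite mulrC subrr.
    by rewrite he.2 // ce.2 // !mulr0 subrr.
  have -> : mapphi h = (phi b)^-1%:MP *: (mapphi h2 + (phi a)%:MP *: mapphi (c e)).
    rewrite mapphiB !map_mpoly_mxC subrK scalerA -mpolyCM mulVf //.
    by rewrite mpolyC1 scale1r.
  apply/UZ/UD => //; exists [:: (phi a, e)]; split.
    by move=> x; rewrite mem_seq1 => /eqP ->.
  by rewrite /tau big_seq1 subrr; apply: (rowspan_submodule _).1.
have Uall h : U (mapphi h).
  by have [/Uker //|/lead_exists[e /Ulead]] := eqVneq (h *m A) 0.
(* Every vector is a [k']-combination of monomial multiples of unit vectors, and these are
   specializations. *)
have UT h : U h.
  have U00 : U 0 by apply/U0/(rowspan_submodule _).1.
  rewrite [h]row_sum_delta; elim/big_ind: _ => // i _.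
  rewrite [h 0 i]mpolyE scaler_suml; elim/big_ind: _ => // m _.
  rewrite -mul_mpolyC -scalerA; apply: UZ.
  rewrite -[X in U X](_ : mapphi ('X_[m] *: delta_mx 0 i) = _) //.
  by apply/rowP => j; rewrite !mxE rmorphM /= map_mpolyX rmorph_nat.
have tau_inj N : forall s, (size s < N)%N -> (forall x, x \in s -> good x.2) ->
    tau s *m mapphi A = 0 -> tau s = 0.
  elim: N => // N IHN s sN gs ts0.
  have [->|[x0 x0s]] : s = [::] \/ exists x0, x0 \in s.
    by case: s {sN gs ts0} => [|x s]; [left|right; exists x; rewrite mem_head].
    by rewrite /tau big_nil.
  have [e es emax] := seq_max (map_f snd x0s).
  have ge : good e by case/mapP: es => x /gs ? ->.
  have se0 : \sum_(x <- s | x.2 == e) x.1 = 0.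
    have := congr1 (fun v => vcoef v e) ts0.
    rewrite mulmx_suml vcoef_sum [vcoef 0 e]/vcoef mxE mcoeff0.
    rewrite (bigID (fun x => x.2 == e)) /= [X in _ + X]big_seq_cond.
    rewrite [X in _ + X]big1 ?addr0 => [|x /andP[xs ne]].
      rewrite (eq_bigr (fun x => x.1 * phi (vcoef (c e *m A) e))).
        by rewrite -mulr_suml => /eqP; rewrite mulf_eq0 (negPf ge.2) orbF => /eqP.
      by move=> x /eqP ->; rewrite -scalemxAl -map_mxM vcoefC vcoef_map.
    rewrite -scalemxAl -map_mxM vcoefC vcoef_map (gs x xs).1.2 ?rmorph0 ?mulr0 //.
    by rewrite lt_neqAle ne emax // map_f.
  have tausE : tau s = tau [seq x <- s | x.2 != e].
    rewrite /tau (bigID (fun x => x.2 == e)) /= big_filter.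
    rewrite (eq_bigr (fun x => x.1%:MP *: mapphi (c e))); last by move=> x /eqP ->.
    by rewrite -scaler_suml -raddf_sum se0 /= mpolyC0 scale0r add0r.
  rewrite tausE; apply: IHN; rewrite -?tausE //.
    rewrite -ltnS; apply: leq_trans sN; rewrite ltnS size_filter.
    rewrite -(count_predC (fun x => x.2 != e)) -[X in (X < _)%N]addn0 ltn_add2l -has_count.
    by case/mapP: es => x xs ->; apply/hasP; exists x => //=; rewrite negbK.
  by move=> x; rewrite mem_filter => /andP[_ /gs].
move=> h hA; have [s [gs [w hw]]] := UT h.
have BA0 : mapphi B *m mapphi A = 0.
  rewrite -map_mxM; suff -> : B *m A = 0 by rewrite map_mx0.
  apply/row_matrixP => i; rewrite row_mul row0; apply/kerB; exact: rowspan_row.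
suff ts0 : tau s = 0 by exists w; rewrite -hw ts0 subr0.
apply: (tau_inj (size s).+1) => //.
by rewrite -[tau s](subKr h) hw mulmxBl hA -mulmxA BA0 mulmx0 subr0.
Qed.
End Kernel.

(** * Points outside a proper subvariety *)

Lemma digits_inj N k (f g : nat -> nat) :
  (forall i, f i < N)%N -> (forall i, g i < N)%N ->
  (\sum_(i < k) f i * N ^ i = \sum_(i < k) g i * N ^ i)%N ->
  forall i, (i < k)%N -> f i = g i.
Proof.
elim: k f g => // k IHk f g fN gN.
have split_sum (h : nat -> nat) : (\sum_(i < k.+1) h i * N ^ i =
    (\sum_(i < k) h i.+1 * N ^ i) * N + h 0)%N.
  rewrite big_ord_recl muln1 addnC big_distrl /=; congr (_ + _)%N.
  by apply: eq_bigr => i _; rewrite /bump /= add1n expnSr mulnA.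
rewrite !split_sum => e; have N0 := leq_ltn_trans (leq0n _) (fN 0%N).
have e0 : f 0%N = g 0%N.
  by have := congr1 (modn^~ N) e; rewrite !modnMDl !modn_small.
case=> // i ik; apply: (IHk (f \o S) (g \o S)) => //=.
by have := congr1 (divn^~ N) e; rewrite !divnMDl // !divn_small // !addn0.
Qed.

Lemma infinite_notin (T : choiceType) (s : seq T) :
  infinite_set [set: T] -> exists x, x \notin s.
Proof.
move=> inf; apply: contrapT => no; apply: inf.
apply: sub_finite_set (finite_seq s) => x _ /=.
by apply: contrapT => /negP xs; apply: no; exists x.
Qed.

Lemma poly_nonroot (F : fieldType) (p : {poly F}) :
  infinite_set [set: F] -> p != 0 -> exists x, ~~ root p x.
Proof.
move=> inf p0; apply: contrapT => no.
have rootp x : root p x by apply: contrapT => /negP px; apply: no; exists x.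
have [s [us ss]] : exists s : seq F, uniq s /\ size s = size p.
  elim: (size p) => [|j [s [us <-]]]; first by exists [::].
  by have [x xs] := infinite_notin s inf; exists (x :: s); rewrite /= xs us.
have alls : all (root p) s by apply/allP.
by have := max_poly_roots p0 alls us; rewrite ss ltnn.
Qed.

(* Kronecker substitution X_i := t ^ (N ^ i). *)
Lemma mpoly_nonvanishing (F : fieldType) m (p : {mpoly F[m]}) :
  infinite_set [set: F] -> p != 0 -> exists a : 'I_m -> F, p.@[a] != 0.
Proof.
(* [msize p] exceeds every exponent in [p], so exponents are base [N] digits and [kappa] separates
   the monomials of [p]. *)
move=> inf p0; pose N := msize p.
pose kappa (mm : 'X_{1..m}) := (\sum_(i < m) mm i * N ^ i)%N.
have supp_lt mm i : mm \in msupp p -> (mm i < N)%N.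
  move=> /msize_mdeg_lt; apply: leq_ltn_trans.
  by rewrite mdegE (bigD1 i) //= leq_addr.
have kappa_inj : {in msupp p &, injective kappa}.
  move=> m1 m2 s1 s2 e; apply/mnmP => i.
  pose ext (mm : 'X_{1..m}) j := if insub j is Some j' then mm j' else 0%N.
  have extE mm (j : 'I_m) : ext mm j = mm j by rewrite /ext valK.
  have ext_lt mm j : mm \in msupp p -> (ext mm j < N)%N.
    rewrite /ext; case: insubP => [j' _ _ /supp_lt|_ ms]; first exact.
    exact: leq_ltn_trans (msize_mdeg_lt ms).
  rewrite -!extE; apply: (digits_inj (N := N) (k := m)) => //;
    try by move=> j; apply: ext_lt.
  by do 2!rewrite (eq_bigr _ (fun j _ => congr1 (muln^~ _) (extE _ j))).
pose q : {poly F} := \sum_(mm <- msupp p) p@_mm *: 'X^(kappa mm).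
have [mm ms] : exists mm, mm \in msupp p.
  by exists (mlead p); apply: mlead_supp.
have q0 : q != 0.
  apply: contraTneq ms => q0; rewrite mcoeff_msupp negbK.
  apply: contraT => pm; have ms : mm \in msupp p by rewrite mcoeff_msupp.
  have := congr1 (fun r : {poly F} => r`_(kappa mm)) q0.
  rewrite coef0 coef_sum (bigD1_seq mm) ?msupp_uniq //= coefZ coefXn eqxx mulr1.
  rewrite big_seq_cond big1 ?addr0 // => [pm0|m' /andP[m's ne]].
    by rewrite pm0 eqxx in pm.
  rewrite coefZ coefXn; case: eqP => [/kappa_inj e|_]; last by rewrite mulr0.
  by rewrite e ?eqxx in ne.
have [t qt] := poly_nonroot inf q0; exists (fun i : 'I_m => t ^+ (N ^ i)).
apply: contraNneq qt => pt; rewrite /root -[X in _ == X]pt horner_sum mevalE.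
apply/eqP/eq_bigr => m' _; rewrite hornerZ hornerXn; congr (_ * _).
by rewrite -prodrXr; apply: eq_bigr => i _; rewrite -exprM mulnC.
Qed.

Section Generic.
Variables (k K : fieldType) (iota : {rmorphism k -> K}) (m : nat).

(** Nonvanishing of one polynomial over [k], rather than [almost_all] over [K]: conjunctions become
    products, and [generic_almost_all] converts at the end. *)
Definition generic (P : ('I_m -> K) -> Prop) : Prop :=
  exists2 d : {mpoly k[m]}, d != 0 &
    forall alpha, eval_at iota alpha d != 0 -> P alpha.

Lemma generic_and P Q : generic P -> generic Q ->
  generic (fun alpha => P alpha /\ Q alpha).
Proof.
move=> [d d0 dP] [e e0 eQ]; exists (d * e); first by rewrite mulf_neq0.
by move=> alpha; rewrite rmorphM mulf_eq0 negb_or => /andP[/dP ? /eQ].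
Qed.

Lemma generic_imply P Q : (forall alpha, P alpha -> Q alpha) ->
  generic P -> generic Q.
Proof. by move=> PQ [d d0 dP]; exists d => // alpha /dP /PQ. Qed.

Lemma meval_map_mpoly alpha (d : {mpoly k[m]}) :
  (map_mpoly iota d).@[alpha] = mmap iota alpha d.
Proof.
rewrite /map_mpoly /mmap raddf_sum; apply: eq_bigr => mm _ /=.
by rewrite mul_mpolyC mevalZ rmorph_prod; congr (_ * _); apply: eq_bigr => i _;
   rewrite rmorphXn /= mevalXU.
Qed.

(** Since [k] is infinite, [d] is nonzero at some point of [k^m], whose image in [K^m] shows that
    the zero locus of [d] is proper. *)
Lemma generic_almost_all P :
  infinite_set [set: k] -> generic P -> almost_all P.
Proof.
move=> inf [d d0 dP]; exists (fun f => f = map_mpoly iota d).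
  have [a da] := mpoly_nonvanishing inf d0; exists (iota \o a).
  move=> /(_ _ erefl) /eqP; rewrite meval_map_mpoly; apply/negP.
  suff -> : mmap iota (iota \o a) d = iota d.@[a] by rewrite fmorph_eq0.
  rewrite mevalE rmorph_sum; apply: eq_bigr => mm _.
  rewrite rmorphM rmorph_prod; congr (_ * _).
  by apply: eq_bigr => i _; rewrite rmorphXn.
move=> alpha nz; apply: dP; apply: contra_notN nz => /eqP/(congr1 val) /= ev0.
by move=> _ ->; rewrite meval_map_mpoly.
Qed.

End Generic.


(** * Submodules compatible with specialization *)

Lemma tofrac_denominator (D : idomainType) (x : {fraction D}) :
  exists2 d : D, d != 0 &
    exists a, FracField.tofrac a = FracField.tofrac d * x.
Proof.
elim/quotW: x => x; exists (\d_x); first exact: denom_ratioP.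
exists (\n_x); change (FracField.tofrac \n_x =
  FracField.mul (FracField.tofrac \d_x) (\pi_({fraction D}) x)).
rewrite [FracField.tofrac \n_x]piE [FracField.tofrac \d_x]piE -[RHS]FracField.pi_mul.
apply/eqmodP; rewrite /= FracField.equivfE /FracField.mulf.
by rewrite !numden_Ratio ?mul1r ?oner_neq0 ?denom_ratioP // mulrC.
Qed.

Lemma tofrac_common_denominator (D : idomainType) (s : seq {fraction D}) :
  exists2 d : D, d != 0 &
    forall x, x \in s -> exists a, FracField.tofrac a = FracField.tofrac d * x.
Proof.
elim: s => [|x s [d d0 ds]]; first by exists 1; rewrite ?oner_neq0.
have [e e0 [a ae]] := tofrac_denominator x.
exists (e * d) => [|y]; first by rewrite mulf_neq0.
rewrite inE => /orP[/eqP ->|/ds[b be]].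
  by exists (d * a); rewrite !tofracM ae mulrCA mulrA.
by exists (e * b); rewrite !tofracM be mulrA.
Qed.

Lemma rowspanZ (A : comUnitRingType) t r (c : A) (B : 'M[A]_(t, r)) v :
  c \is a GRing.unit -> rowspan (c *: B) v <-> rowspan B v.
Proof.
move=> cu; split=> -[w ->]; last first.
  by exists (c^-1 *: w); rewrite -scalemxAl -scalemxAr scalerA mulVr // scale1r.
by exists (c *: w); rewrite -scalemxAl scalemxAr.
Qed.

Lemma rowspan_unitZ (A : comUnitRingType) t r (c : A) (B : 'M[A]_(t, r)) v :
  c \is a GRing.unit -> rowspan B (c *: v) -> rowspan B v.
Proof.
move=> cu /(submoduleZ (rowspan_submodule B) c^-1).
by rewrite scalerA mulVr // scale1r.
Qed.

Lemma rowspan_mul (A : comNzRingType) t r s (B : 'M[A]_(t, r)) (C : 'M_(s, t)) v :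
  rowspan (C *m B) v <-> exists2 w, rowspan C w & v = w *m B.
Proof.
split=> [[y ->]|[_ [y ->] ->]]; last by exists y; rewrite mulmxA.
by exists (y *m C); [exists y|rewrite mulmxA].
Qed.

Lemma rowspan_col_mx (A : comNzRingType) t s r (B : 'M[A]_(t, r)) (C : 'M_(s, r)) v :
  rowspan (col_mx B C) v <-> exists u w, [/\ rowspan B u, rowspan C w & v = u + w].
Proof.
split=> [[y ->]|[_ [_ [[x ->] [y ->] ->]]]]; last first.
  by exists (row_mx x y); rewrite mul_row_col.
exists (lsubmx y *m B), (rsubmx y *m C); split.
- by exists (lsubmx y).
- by exists (rsubmx y).
by rewrite -mul_row_col hsubmxK.
Qed.

Lemma rowspan_factor (A : comNzRingType) t s r (B : 'M[A]_(t, r)) (C : 'M_(s, r)) :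
  (forall v, rowspan B v -> rowspan C v) -> exists X, B = X *m C.
Proof.
move=> BC; have /choice[x xP] i : exists x, row i B = x *m C by apply/BC/rowspan_row.
by exists (\matrix_i x i); apply/row_matrixP => i; rewrite row_mul rowK xP.
Qed.

(* The preimage of the row space of Q under M is read off the relations between
   the rows of M and Q. *)
Lemma preimage_kernel (A : comNzRingType) p q l t (M : 'M[A]_(p, q))
    (Q : 'M_(l, q)) (B : 'M_(t, p + l)) :
  (forall h, h *m col_mx M Q = 0 <-> rowspan B h) ->
  forall v, rowspan Q (v *m M) <-> rowspan (lsubmx B) v.
Proof.
move=> kerB v; split=> [[z e]|[y ->]].
  have /kerB[y ye] : row_mx v (- z) *m col_mx M Q = 0.
    by rewrite mul_row_col mulNmx e subrr.
  exists y; have := congr1 lsubmx ye; rewrite row_mxKl => ->.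
  by rewrite -[in LHS](hsubmxK B) mul_mx_row row_mxKl.
have /kerB : rowspan B (y *m B) by exists y.
rewrite -(hsubmxK B) mul_mx_row mul_row_col hsubmxK => /eqP.
by rewrite addr_eq0 => /eqP ->; exists (- (y *m rsubmx B)); rewrite mulNmx.
Qed.

Lemma map_mx_injective (A B : Type) (f : A -> B) s r :
  injective f -> injective (map_mx f : 'M_(s, r) -> 'M_(s, r)).
Proof.
move=> finj M N /matrixP e; apply/matrixP => i j; have := e i j; rewrite !mxE.
exact: finj.
Qed.

Lemma unit_mpolyC (F : fieldType) n (c : F) :
  c != 0 -> (c%:MP : {mpoly F[n]}) \is a GRing.unit.
Proof. by move=> c0; apply: rmorph_unit; rewrite unitfE. Qed.

Lemma mpoly_common_denominator (D : idomainType) (F : fieldType)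
    (frac : {rmorphism D -> F}) n :
  (forall s : seq F, exists2 d : D, d != 0 &
     forall x, x \in s -> exists a, frac a = frac d * x) ->
  forall s r (M : 'M[{mpoly F[n]}]_(s, r)), exists2 d : D, d != 0 &
    exists M0, map_mx (map_mpoly frac) M0 = (frac d)%:MP *: M.
Proof.
move=> cd s r M; pose l := [seq (M ij.1 ij.2)@_mm | ij <- enum {: 'I_s * 'I_r},
             mm <- msupp (M ij.1 ij.2)].
have [d d0 dl] := cd l; exists d => //.
have /choice[a aP] x : exists a, x \in l -> frac a = frac d * x.
  by have [/dl[a ?]|_] := boolP (x \in l); [exists a|exists 0].
exists (\matrix_(i, j) \sum_(mm <- msupp (M i j)) a (M i j)@_mm *: 'X_[mm]).
apply/matrixP => i j; rewrite !mxE [in RHS](mpolyE (M i j)) rmorph_sum mulr_sumr.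
rewrite !big_seq; apply: eq_bigr => mm mmM.
rewrite mul_mpolyC scalerA -aP; last first.
  by apply/allpairsPdep; exists (i, j), mm; rewrite mem_enum.
by rewrite /= map_mpolyZ map_mpolyX.
Qed.

Lemma kernel_finitely_generated (D : comNzRingType) n p q
    (A : 'M[{mpoly D[n]}]_(p, q)) : noetherian D ->
  exists t, exists B : 'M_(t, p), forall v, v *m A = 0 <-> rowspan B v.
Proof.
move=> nD; apply: finitely_generated => //; split; first by rewrite mul0mx.
by move=> a u v u0 v0; rewrite mulmxDl -scalemxAl u0 v0 scaler0 addr0.
Qed.

Section Tracking.
Variables (k K : fieldType) (iota : {rmorphism k -> K}) (m n : nat).

Local Notation D := {mpoly k[m]}.
Local Notation S := {mpoly D[n]}.
Local Notation R := {mpoly {fraction D}[n]}.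
Local Notation frac := (@FracField.tofrac D).
Local Notation incl := (map_mx (@kux_incl k m n)).
Local Notation ev alpha := (eval_at iota alpha).
Local Notation R_ alpha := {mpoly (adjoin iota alpha)[n]}.
Local Notation phi alpha := (map_mx (@spec_poly k K iota m n alpha)).
Local Notation generic := (@generic k K iota m).

Lemma kux_incl_inj : injective (@kux_incl k m n).
Proof.
move=> x y /mpolyP exy; apply/mpolyP => mm; have := exy mm.
rewrite [LHS]mcoeff_map_mpoly [RHS]mcoeff_map_mpoly => /eqP.
by rewrite tofrac_eq => /eqP.
Qed.

HB.instance Definition _ := GRing.RMorphism.copy (@kux_incl k m n)
  (map_mpoly frac).
HB.instance Definition _ alpha :=
  GRing.RMorphism.copy (@spec_poly k K iota m n alpha) (map_mpoly (ev alpha)).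

Lemma incl_inj s r (M N : 'M[S]_(s, r)) : incl M = incl N -> M = N.
Proof. exact: (map_mx_injective kux_incl_inj). Qed.

Lemma inclM s r t (M : 'M[S]_(s, r)) (N : 'M_(r, t)) :
  incl (M *m N) = incl M *m incl N.
Proof. exact: map_mxM. Qed.

Lemma phiM alpha s r t (M : 'M[S]_(s, r)) (N : 'M_(r, t)) :
  phi alpha (M *m N) = phi alpha M *m phi alpha N.
Proof. exact: map_mxM. Qed.

Lemma inclC s r d (M : 'M[S]_(s, r)) :
  incl (d%:MP *: M) = (frac d)%:MP *: incl M.
Proof. exact: map_mpoly_mxC. Qed.

Lemma phiC alpha s r d (M : 'M[S]_(s, r)) :
  phi alpha (d%:MP *: M) = (ev alpha d)%:MP *: phi alpha M.
Proof. exact: map_mpoly_mxC. Qed.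

Lemma clear_denominators s r (M : 'M[R]_(s, r)) :
  exists2 d : D, d != 0 & exists M0, incl M0 = (frac d)%:MP *: M.
Proof. exact: mpoly_common_denominator (@tofrac_common_denominator _) _ _ _. Qed.

(** The pairs [(M0 i j, d)] present all entries with one denominator, and [specE] evaluates each
    entry through its pair. *)
Lemma spec_mx_spread alpha s r (M : 'M[R]_(s, r)) d M0 :
  incl M0 = (frac d)%:MP *: M -> d != 0 -> ev alpha d != 0 ->
  specializable_mx iota alpha M /\
  spec_mx iota alpha M = ((ev alpha d)^-1)%:MP *: phi alpha M0.
Proof.
move=> e d0 da.
have sf i j : spec_fraction iota alpha (M i j) (M0 i j, d).
  split=> //=; have := congr1 (fun N : 'M__ => N i j) e; rewrite !mxE => ->.
  by rewrite mul_mpolyC scalerK // tofrac_eq0.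
split=> [i j|]; first by exists (M0 i j, d).
by apply/matrixP => i j; rewrite !mxE (specE (sf i j)) mul_mpolyC.
Qed.

(* For almost all alpha, Na alpha is the specialization of N. *)
Definition tracked r (N : 'rV[R]_r -> Prop)
    (Na : forall alpha : 'I_m -> K, 'rV[R_ alpha]_r -> Prop) : Prop :=
  exists l, exists Q : 'M[S]_(l, r), (forall v, N v <-> rowspan (incl Q) v) /\
    generic (fun alpha => forall v, Na alpha v <-> rowspan (phi alpha Q) v).

Lemma tracked_ext r N N' Na N'a :
  @tracked r N Na -> (forall v, N v <-> N' v) ->
  (forall alpha v, Na alpha v <-> N'a alpha v) -> @tracked r N' N'a.
Proof.
move=> [l [Q [NQ NaQ]]] NN' NaN'a; exists l, Q; split=> [v|].
  by rewrite -NN'.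
by apply: generic_imply NaQ => alpha h v; rewrite -NaN'a.
Qed.

Lemma tracked_rowspan l r (Q : 'M[S]_(l, r)) :
  tracked (rowspan (incl Q)) (fun alpha => rowspan (phi alpha Q)).
Proof. by exists l, Q; split=> //; exists 1; rewrite ?oner_neq0. Qed.

(** Clearing denominators multiplies the matrix by a unit, both over [R] and, when [d] does not
    vanish at [alpha], after specialization; row spaces are unchanged. *)
Lemma tracked_spec_mx s r (M : 'M[R]_(s, r)) :
  tracked (rowspan M) (fun alpha => rowspan (spec_mx iota alpha M)).
Proof.
have [d d0 [M0 e]] := clear_denominators M; exists s, M0; split=> [v|].
  by rewrite e rowspanZ // unit_mpolyC // tofrac_eq0.
exists d; first exact: d0.
move=> alpha da v; have [_ ->] := spec_mx_spread e d0 da.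
by apply: rowspanZ; apply: unit_mpolyC; rewrite invr_eq0.
Qed.

Lemma generic_specializable s r (M : 'M[R]_(s, r)) :
  generic (fun alpha => specializable_mx iota alpha M).
Proof.
have [d d0 [M0 e]] := clear_denominators M.
by exists d => // alpha da; apply: (spec_mx_spread e d0 da).1.
Qed.

(** The inclusion is a matrix factorization over [R]. With denominators cleared it becomes an
    identity over [k[u,x]] with a factor [c] in [k[u]], which can be specialized and divided by [c]
    wherever [c] does not vanish. *)
Lemma tracked_sub r N N' Na N'a :
  @tracked r N Na -> tracked N' N'a -> (forall v, N v -> N' v) ->
  generic (fun alpha => forall v, Na alpha v -> N'a alpha v).
Proof.
move=> [l [Q [NQ NaQ]]] [l' [Q' [NQ' NaQ']]] NN'.
have [X QX] : exists X, incl Q = X *m incl Q'.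
  by apply: rowspan_factor => v; rewrite -NQ -NQ'; apply: NN'.
have [c c0 [X0 X0E]] := clear_denominators X.
have QX0 : c%:MP *: Q = X0 *m Q'.
  apply: incl_inj; rewrite inclC inclM X0E QX; exact: scalemxAl.
have gc : generic (fun alpha => ev alpha c != 0) by exists c.
apply: generic_imply (generic_and gc (generic_and NaQ NaQ')).
move=> alpha [ca [aQ aQ']] v; rewrite aQ aQ'.
rewrite -(rowspanZ _ _ (unit_mpolyC _ ca)) -phiC QX0 phiM.
by move=> /rowspan_mul[w _ ->]; exists w.
Qed.

(** Specializations computed from two descriptions of one submodule agree generically, so either may
    be used. *)
Lemma tracked_eq r N Na N'a :
  @tracked r N Na -> tracked N N'a ->
  generic (fun alpha => forall v, Na alpha v <-> N'a alpha v).
Proof.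
move=> h h'.
apply: generic_imply (generic_and (tracked_sub h h' _) (tracked_sub h' h _)) => //.
by move=> alpha [s s'] v; split; [apply: s|apply: s'].
Qed.

Lemma noetherian_coef : noetherian D.
Proof. exact/noetherian_mpoly/noetherian_field. Qed.

(** The relations between the rows of [col_mx M Q] are computed once over [k[u,x]]. Their generators
    [B] still generate over [R], by clearing denominators, and generically after specialization, by
    [kernel_specialization]; [preimage_kernel] applies in both cases. *)
Lemma tracked_preimage p q (M : 'M[S]_(p, q)) N Na : @tracked q N Na ->
  tracked (fun v => N (v *m incl M)) (fun alpha v => Na alpha (v *m phi alpha M)).
Proof.
move=> [l [Q [NQ NaQ]]]; pose A := col_mx M Q.
have [t [B kerB]] := kernel_finitely_generated A noetherian_coef.
have BA0 : B *m A = 0.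
  by apply/row_matrixP => i; rewrite row_mul row0; apply/kerB/rowspan_row.
exists t, (lsubmx B); split=> [v|].
  rewrite NQ map_lsubmx; apply: preimage_kernel => h.
  rewrite -map_col_mx; split=> [hA|[y ->]]; last first.
    by rewrite -mulmxA -inclM BA0 map_mx0 mulmx0.
  have [c c0 [h0 h0E]] := clear_denominators h.
  have /kerB[y h0y] : h0 *m A = 0.
    by apply: incl_inj; rewrite inclM h0E -scalemxAl hA scaler0 map_mx0.
  have cu : (frac c)%:MP \is a @GRing.unit R by rewrite unit_mpolyC // tofrac_eq0.
  by apply: (rowspan_unitZ cu); rewrite -h0E h0y inclM; exists (incl y).
have [d d0 dsurv] := generic_leads_survive A.
have gd : generic (fun alpha => ev alpha d != 0) by exists d.
apply: generic_imply (generic_and gd NaQ) => alpha [da aQ] v.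
rewrite aQ map_lsubmx; apply: preimage_kernel => h.
rewrite -map_col_mx; split=> [|[y ->]]; last first.
  by rewrite -mulmxA -phiM BA0 map_mx0 mulmx0.
exact: (kernel_specialization (dsurv _ _ da) kerB).
Qed.

(** With [N] the row space of [Q], the intersection is the image under [Q] of the preimage of [N']
    under [Q]. *)
Lemma tracked_inter r N N' Na N'a : @tracked r N Na -> tracked N' N'a ->
  tracked (fun v => N v /\ N' v) (fun alpha v => Na alpha v /\ N'a alpha v).
Proof.
move=> [l [Q [NQ NaQ]]] /(tracked_preimage Q)[t [E [N'E N'aE]]].
exists t, (E *m Q); split=> [v|].
  rewrite NQ inclM rowspan_mul; split=> [[[w ->] /N'E ?]|[w /N'E N'w ->]].
    by exists w.
  by split=> //; exists w.
apply: generic_imply (generic_and NaQ N'aE) => alpha [aQ aE] v.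
rewrite aQ phiM rowspan_mul; split=> [[[w ->] /aE ?]|[w /aE N'w ->]].
  by exists w.
by split=> //; exists w.
Qed.

Lemma tracked_add r N N' Na N'a : @tracked r N Na -> tracked N' N'a ->
  tracked (fun v => exists u w, [/\ N u, N' w & v = u + w])
    (fun alpha v => exists u w, [/\ Na alpha u, N'a alpha w & v = u + w]).
Proof.
move=> [l [Q [NQ NaQ]]] [l' [Q' [NQ' NaQ']]]; exists (l + l')%N, (col_mx Q Q').
split=> [v|].
  rewrite map_col_mx rowspan_col_mx; split=> -[u [w [/NQ ? /NQ' ? ->]]];
  by exists u, w.
apply: generic_imply (generic_and NaQ NaQ') => alpha [aQ aQ'] v.
rewrite map_col_mx rowspan_col_mx; split=> -[u [w [/aQ ? /aQ' ? ->]]];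
by exists u, w.
Qed.

Lemma tracked_setT r :
  @tracked r (fun=> True) (fun _ _ => True).
Proof.
apply: tracked_ext (tracked_rowspan 1%:M) _ _ => [v|alpha v]; split=> // _;
by exists v; rewrite map_mx1 mulmx1.
Qed.

(** The colon by one [f] is the preimage under the scalar matrix [f%:M]; a list is handled by
    intersections, starting from the whole module. *)
Lemma tracked_colon r (l : seq S) N Na : @tracked r N Na ->
  tracked (fun v => forall f, f \in l -> N (kux_incl f *: v))
    (fun alpha v => forall f, f \in l -> Na alpha (spec_poly iota alpha f *: v)).
Proof.
move=> tN; elim: l => [|f l IHl].
  by apply: tracked_ext (tracked_setT r) _ _.
have tf := tracked_preimage f%:M tN.
have memE (P : S -> Prop) : (P f /\ forall g, g \in l -> P g) <->
    forall g, g \in f :: l -> P g.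
  split=> [[Pf Pl] g|h]; first by rewrite inE => /orP[/eqP ->|/Pl].
  by split=> [|g gl]; apply: h; rewrite ?mem_head // inE gl orbT.
apply: tracked_ext (tracked_inter tf IHl) _ _ => [v|alpha v];
by rewrite -memE // map_scalar_mx mul_mx_scalar.
Qed.

End Tracking.

Section IdealAdd.
Variables (A : comNzRingType) (r : nat).

(** For a submodule [N] this is $N+(l)A^r$, the preimage in $A^r$ of the product of the ideal $(l)$
    with $A^r/N$. The recursion matches [tracked_add]. *)
Fixpoint ideal_add (l : seq A) (N : 'rV[A]_r -> Prop) : 'rV[A]_r -> Prop :=
  if l is f :: l' then
    fun v => exists u w, [/\ rowspan (f%:M : 'M_r) u, ideal_add l' N w & v = u + w]
  else N.

Lemma ideal_add_min l (N N' : 'rV[A]_r -> Prop) :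
  is_submodule N' -> (forall v, N v -> N' v) ->
  (forall f w, f \in l -> N' (f *: w)) ->
  forall v, ideal_add l N v -> N' v.
Proof.
move=> hN' NN'; elim: l => [//|f l IHl] lN' _ [_ [w [[u ->] lw ->]]].
apply: submoduleD => //; first by rewrite mul_mx_scalar; apply: lN'; rewrite mem_head.
by apply: IHl lw => g w' gl; apply: lN'; rewrite inE gl orbT.
Qed.

Lemma ideal_add_submodule l (N : 'rV[A]_r -> Prop) :
  is_submodule N -> is_submodule (ideal_add l N).
Proof.
move=> hN; elim: l => //= f l IHl; split.
  exists 0, 0; split; last by rewrite addr0.
    exact: (rowspan_submodule _).1.
  exact: IHl.1.
move=> a _ _ [u [w [hu hw ->]]] [u' [w' [hu' hw' ->]]].
exists (a *: u + u'), (a *: w + w'); split.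
- exact: (rowspan_submodule _).2.
- exact: IHl.2.
by rewrite scalerDr addrACA.
Qed.

Lemma ideal_add_sub l (N : 'rV[A]_r -> Prop) v : N v -> ideal_add l N v.
Proof.
move=> Nv; elim: l => //= f l IHl; exists 0, v; split=> //; last by rewrite add0r.
exact: (rowspan_submodule _).1.
Qed.

Lemma ideal_add_mul l (N : 'rV[A]_r -> Prop) f w :
  is_submodule N -> f \in l -> ideal_add l N (f *: w).
Proof.
move=> hN; elim: l => //= g l IHl; rewrite inE => /orP[/eqP ->|fl].
  exists (g *: w), 0; split; last by rewrite addr0.
    by exists w; rewrite mul_mx_scalar.
  by apply: ideal_add_sub; apply: (submodule0 hN).
exists 0, (f *: w); split; last by rewrite add0r.
  exact: (rowspan_submodule _).1.
exact: IHl.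
Qed.
End IdealAdd.

Lemma tracked_ideal_add (k K : fieldType) (iota : {rmorphism k -> K}) m n r
    (l : seq {mpoly {mpoly k[m]}[n]}) N Na : @tracked k K iota m n r N Na ->
  tracked (ideal_add (map (@kux_incl k m n) l) N)
    (fun alpha => ideal_add (map (spec_poly iota alpha) l) (Na alpha)).
Proof.
move=> tN; elim: l => //= f l IHl.
apply: tracked_ext (tracked_add (tracked_rowspan iota f%:M) IHl) _ _.
  by move=> v; rewrite map_scalar_mx.
by move=> alpha v; rewrite map_scalar_mx.
Qed.

(** * Cokernels and ideals *)

Lemma submod_val_linear (A : comNzRingType) (M : lmodType A) (N : submodule M) :
  linear (@submod_val A M N).
Proof. by move=> a u v; rewrite -[RHS](linearP (val : submod N -> M)). Qed.

HB.instance Definition _ (A : comNzRingType) (M : lmodType A) (N : submodule M) :=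
  GRing.isLinear.Build A (submod N) M *:%R (@submod_val A M N)
    (@submod_val_linear A M N).

Section CokerTheory.
Variables (A : comNzRingType) (s r : nat) (P : 'M[A]_(s, r)).

Lemma rowimageP v : v \in rowimage P <-> rowspan P v.
Proof. by split=> /asboolP. Qed.

Definition coker_pi (v : 'rV[A]_r) : coker P :=
  \pi_(quotmod (Submodule (rowimage_closed P))) v.

Lemma coker_pi_eq u v : coker_pi u = coker_pi v <-> rowspan P (u - v).
Proof. by rewrite -rowimageP; apply: quotmod_piP. Qed.

Lemma coker_pi_linear : linear coker_pi.
Proof.
move=> a u v; rewrite /coker_pi quotmod_pi_add; congr (_ + _).
by symmetry; apply: quotmod_pi_scale.
Qed.

HB.instance Definition _ :=
  GRing.isLinear.Build A 'rV[A]_r (coker P) *:%R coker_pi coker_pi_linear.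

Lemma coker_pi_eq0 v : coker_pi v = 0 <-> rowspan P v.
Proof.
rewrite -[v in rowspan P v]subr0 -coker_pi_eq.
by rewrite (raddf0 (coker_pi : {linear _ -> _})).
Qed.

Lemma coker_repr (y : coker P) : coker_pi (repr y) = y.
Proof. exact: reprK. Qed.

End CokerTheory.

(** The map sends the class of [v] to that of [v *m C]. The first hypothesis makes it well defined
    and injective, the second makes [N] its image. *)
Lemma coker_submod_iso (A : comNzRingType) s r s' r' (P : 'M[A]_(s, r))
    (Q : 'M[A]_(s', r')) (C : 'M[A]_(r', r)) (N : submodule (coker P)) :
  (forall v, rowspan Q v <-> rowspan P (v *m C)) ->
  (forall w, coker_pi P w \in N <-> rowspan (col_mx C P) w) ->
  lmod_iso (coker Q) (submod N).
Proof.
move=> QP NCP.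
have NC v : coker_pi P (v *m C) \in N.
  by apply/NCP/rowspan_col_mx; exists (v *m C), 0; split;
     [exists v|apply: (rowspan_submodule _).1|rewrite addr0].
pose f (y : coker Q) : submod N := Submod (NC (repr y)).
have fpi v : submod_val (f (coker_pi Q v)) = coker_pi P (v *m C).
  by apply/coker_pi_eq; rewrite -mulmxBl; apply/QP/coker_pi_eq/coker_repr.
have f_lin : linear f.
  move=> a y z; rewrite -(coker_repr y) -(coker_repr z).
  rewrite -(linearP (coker_pi Q : {linear _ -> _})).
  apply: val_inj; rewrite [LHS]fpi.
  rewrite [RHS]submod_val_linear !fpi mulmxDl -scalemxAl.
  exact: coker_pi_linear.
pose F : {linear coker Q -> submod N} :=
  HB.pack f (GRing.isLinear.Build _ _ _ _ f f_lin).
exists F.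
have /choice[g fg] y : exists x, f x = y.
  have : coker_pi P (repr (submod_val y)) \in N.
    by rewrite coker_repr; apply: submod_valP.
  move=> /NCP/rowspan_col_mx[_ [w [[v ->] Pw e]]].
  exists (coker_pi Q v); apply: val_inj; rewrite [LHS]fpi.
  rewrite -[RHS]coker_repr; apply/coker_pi_eq.
  by rewrite e opprD addNKr; apply: (submoduleN (rowspan_submodule _)).
exists g => // x; rewrite /=; have := fg (f x).
move: (g (f x)) => z /(congr1 (@submod_val _ _ _)).
rewrite -{1}(coker_repr z) -{1}(coker_repr x) !fpi => /coker_pi_eq.
by rewrite -mulmxBl => /QP /coker_pi_eq; rewrite !coker_repr.
Qed.

(** [C] lifts the inclusion of [N] in [L] to the free modules, by a choice of lift for each
    generator of [N]. The two conclusions have the shape of the hypotheses of [coker_submod_iso]. *)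
Lemma submodule_presentation (A : comNzRingType) (L : lmodType A)
    (PL : presentation L) (N : submodule L) (PN : presentation (submod N)) :
  exists C : 'M[A]_(ngen PN, ngen PL),
    (forall v, rowspan (pmx PN) v <-> rowspan (pmx PL) (v *m C)) /\
    (forall w, paug PL w \in N <-> rowspan (col_mx C (pmx PL)) w).
Proof.
have /choice[c cP] i : exists c, paug PL c = submod_val (paug PN (delta_mx 0 i)).
  exact: paug_surj.
exists (\matrix_i c i).
have CE v : paug PL (v *m \matrix_i c i) = submod_val (paug PN v).
  rewrite mulmx_sum_row [in RHS](row_sum_delta v) linear_sum [in RHS]linear_sum.
  rewrite (linear_sum (@submod_val _ _ N : {linear _ -> _})); apply: eq_bigr => i _.
  by rewrite rowK linearZ [in RHS]linearZ /= cP.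
split=> [v|w].
  rewrite -!rowimageP -!paug_exact CE; split=> [->//|e].
  exact: val_inj.
rewrite rowspan_col_mx; split=> [wN|[_ [u [[v ->] /rowimageP/paug_exact u0 ->]]]].
  have [v ve] := paug_surj PN (Submod wN).
  exists (v *m \matrix_i c i), (w - v *m \matrix_i c i); split.
  - by exists v.
  - by apply/rowimageP/paug_exact; rewrite linearB /= CE ve subrr.
  - by rewrite addrC subrK.
by rewrite linearD u0 addr0 /= CE; apply: submod_valP.
Qed.

Section SubmoduleSpecialization.
Variables (k K : fieldType) (iota : {rmorphism k -> K}) (m n : nat).
Local Notation R := {mpoly {fraction {mpoly k[m]}}[n]}.

(** The two properties of [C] from [submodule_presentation] are equalities between tracked
    submodules, so [tracked_eq] carries them over to almost all [alpha], where [coker_submod_iso]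
    applies. *)
Lemma submodule_specialization (L : lmodType R) (PL : presentation L)
    (N : submodule L) (PN : presentation (submod N))
    (Na : forall alpha : 'I_m -> K, submodule (coker (spec_mx iota alpha (pmx PL)))) :
  tracked (iota := iota) (fun w => paug PL w \in N)
    (fun alpha w => coker_pi (spec_mx iota alpha (pmx PL)) w \in Na alpha) ->
  generic iota (fun alpha => lmod_iso (coker (spec_mx iota alpha (pmx PN)))
                                      (submod (Na alpha))).
Proof.
move=> tN; have [C [CPN CN]] := submodule_presentation PL PN.
(* [C] is replaced by its multiple [C0] over [k[u,x]]; the factor is a unit of [R], so both
   properties persist. *)
have [c c0 [C0 C0E]] := clear_denominators C.
have cu : (FracField.tofrac c)%:MP \is a @GRing.unit R.
  by apply: unit_mpolyC; rewrite tofrac_eq0.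
pose inc := map_mx (@kux_incl k m n).
have tP := tracked_spec_mx iota (pmx PL).
have e1 := tracked_eq (tracked_ext (tracked_spec_mx iota (pmx PN))
  (N' := fun v => rowspan (pmx PL) (v *m inc _ _ C0)) _ (fun _ _ => iff_refl _))
  (tracked_preimage C0 tP).
have e2 := tracked_eq (tracked_ext tN (N' := fun w => exists u v,
    [/\ rowspan (inc _ _ C0) u, rowspan (pmx PL) v & w = u + v]) _
    (fun _ _ => iff_refl _))
  (tracked_add (tracked_rowspan iota C0) tP).
apply: generic_imply (generic_and (e1 _) (e2 _)) => [alpha [h1 h2]|v|w].
- apply: (coker_submod_iso (C := map_mx (spec_poly iota alpha) C0)) => [//|w].
  by rewrite h2 rowspan_col_mx.
- rewrite CPN /inc C0E -scalemxAr; split; last exact: rowspan_unitZ.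
  exact: (submoduleZ (rowspan_submodule _)).
rewrite CN rowspan_col_mx /inc C0E.
by split=> -[u [v [hu hv ->]]]; exists u, v; split=> //; apply/(rowspanZ _ _ cu).
Qed.

End SubmoduleSpecialization.

Lemma ideal_generated_by_ideal (A : comNzRingType) (G : A -> Prop) :
  is_ideal (ideal_generated_by G).
Proof.
split=> [J hJ _|a b ha hb J hJ GJ|a b hb J hJ GJ]; first exact: ideal0.
  by apply: idealD => //; [apply: ha|apply: hb].
by apply: idealM => //; apply: hb.
Qed.

Lemma mem_ideal_generated (A : comNzRingType) (G : A -> Prop) a :
  G a -> ideal_generated_by G a.
Proof. by move=> Ga J _; apply. Qed.

Lemma ideal_preimage (A B : comNzRingType) (f : {rmorphism A -> B}) (J : B -> Prop) :
  is_ideal J -> is_ideal (fun a => J (f a)).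
Proof.
move=> hJ; split; rewrite ?rmorph0; first exact: ideal0.
  by move=> a b; rewrite rmorphD; apply: idealD.
by move=> a b; rewrite rmorphM; apply: idealM.
Qed.

Lemma ideal_finitely_generated (D : comNzRingType) n (J : {mpoly D[n]} -> Prop) :
  noetherian D -> is_ideal J -> exists l : seq {mpoly D[n]},
    forall g, J g <-> ideal_generated_by (fun f => f \in l) g.
Proof.
move=> nD hJ; pose N (v : 'rV[{mpoly D[n]}]_1) := J (v 0 0).
have hN (J' : {mpoly D[n]} -> Prop) :
    is_ideal J' -> is_submodule (fun v : 'rV[{mpoly D[n]}]_1 => J' (v 0 0)).
  move=> hJ'; split; first by rewrite mxE; apply: ideal0.
  by move=> a u v hu hv; rewrite !mxE; apply: idealD => //; apply: idealM.
have [l [lN Nl]] := hilbert_basis nD (hN J hJ).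
exists [seq v 0 0 | v : 'rV[{mpoly D[n]}]_1 <- l] => g.
split=> [Jg J' hJ' lJ'|]; last first.
  by apply=> // _ /mapP[v /lN Jv ->].
have := Nl (const_mx g); rewrite mxE => /(_ Jg _ (hN J' hJ')); rewrite mxE; apply.
by move=> v vl; apply/lJ'/mapP; exists v.
Qed.

Section GeneratedIdeal.
Variables (A : comNzRingType) (M : lmodType A) (s r : nat) (P : 'M[A]_(s, r)).
Variables (aug : {linear 'rV[A]_r -> M}) (I : A -> Prop) (G : seq A).
Hypothesis aug_exact : forall v, aug v = 0 <-> rowspan P v.
Hypothesis aug_surj : forall y, exists v, aug v = y.
Hypothesis IG : forall a, I a <-> ideal_generated_by (fun f => f \in G) a.

(** The scalars killing a fixed [aug w] form an ideal, so it suffices to test generators of [I]. *)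
Lemma ann_generated w : aug w \in Submodule (ann_closed M I) <->
  forall f, f \in G -> rowspan P (f *: w).
Proof.
split=> [/asboolP h f fG|h].
  rewrite -aug_exact linearZ; apply/h/IG; exact: mem_ideal_generated.
apply/asboolP => a /IG ha.
apply: (ha (fun a => a *: aug w = 0)) => [|f /h]; last by rewrite -aug_exact linearZ.
split=> [|b c hb hc|b c hc]; first by rewrite scale0r.
  by rewrite scalerDl hb hc addr0.
by rewrite -scalerA hc scaler0.
Qed.

(** One direction is [ideal_add_min]. For the other, the scalars that multiply every row vector into
    [ideal_add G (rowspan P)] form an ideal containing [G], hence containing [I]. *)
Lemma ideal_mul_generated w : aug w \in Submodule (ideal_mul_closed M I) <->
  ideal_add G (rowspan P) w.
Proof.
have hP := rowspan_submodule P; have hS := ideal_add_submodule G hP.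
split=> [/asboolP[l lI e]|]; last first.
  apply: (ideal_add_min (N' := fun w => aug w \in Submodule (ideal_mul_closed M I))).
  - split; first by rewrite linear0 rpred0.
    by move=> a u v hu hv; rewrite linearP rpredD // rpredZ.
  - by move=> v /aug_exact ->; rewrite rpred0.
  move=> f v fG; apply/asboolP; exists [:: (f, aug v)].
    by move=> c; rewrite mem_seq1 => /eqP -> /=; apply/IG; exact: mem_ideal_generated.
  by rewrite big_seq1 linearZ.
have IS a : I a -> forall v, ideal_add G (rowspan P) (a *: v).
  move=> /IG ha; apply: (ha (fun a => forall v, ideal_add G (rowspan P) (a *: v)));
    last by move=> f fG v; apply: ideal_add_mul.
  split=> [v|b c hb hc v|b c hc v].
  - by rewrite scale0r; apply: hS.1.
  - by rewrite scalerDl; apply: (submoduleD hS).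
  - by rewrite -scalerA; apply: (submoduleZ hS).
have /choice[sec secK] := aug_surj.
(* Lifting the summands through the section [sec] gives a vector with the same image as [w], so the
   difference is a relation. *)
rewrite -[w](subrK (\sum_(c <- l) c.1 *: sec c.2)).
apply: (submoduleD hS).
  apply/ideal_add_sub/aug_exact; rewrite linearB e linear_sum -sumrB.
  by rewrite big1 // => c _; rewrite linearZ /= secK subrr.
by apply: (submodule_sum hS) => c cl; apply/IS/lI.
Qed.

End GeneratedIdeal.

Section IdealSpecialization.
Variables (k K : fieldType) (iota : {rmorphism k -> K}) (m n : nat).
Local Notation R := {mpoly {fraction {mpoly k[m]}}[n]}.
Local Notation S := {mpoly {mpoly k[m]}[n]}.

(* The generators are taken for the contraction of I to k[u,x], so that they
   also generate every specialization of I. *)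
Lemma ideal_specialization (I : R -> Prop) : is_ideal I ->
  exists l : seq S,
    (forall a, I a <->
      ideal_generated_by (fun f => f \in map (@kux_incl k m n) l) a) /\
    forall (alpha : 'I_m -> K) b, spec_ideal iota alpha I b <->
      ideal_generated_by (fun f => f \in map (spec_poly iota alpha) l) b.
Proof.
move=> hI; have hJ := @ideal_preimage S R (@kux_incl k m n) I hI.
have [l lP] := ideal_finitely_generated (@noetherian_coef k m) hJ.
have lI f : f \in l -> I (kux_incl f).
  by move=> fl; apply/lP; exact: mem_ideal_generated.
have pull (T : comNzRingType) (f : {rmorphism S -> T}) g : I (kux_incl g) ->
    ideal_generated_by (fun b => b \in map f l) (f g).
  move=> /lP hg; apply: (hg (fun a => ideal_generated_by (fun b => b \in map f l) (f a))).
    exact: (@ideal_preimage S T f _ (ideal_generated_by_ideal _)).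
  by move=> h hl; apply: mem_ideal_generated; apply: map_f.
exists l; split=> [a|alpha b]; split.
(* A denominator [c] brings [a] into the image of the contraction, and [c] is a unit of [R]. *)
- move=> Ia; have [c c0 [M0 e]] := clear_denominators (const_mx a : 'M_1).
  have ae : kux_incl (M0 0 0) = (FracField.tofrac c)%:MP * a.
    by have := congr1 (fun N : 'M_1 => N 0 0) e; rewrite !mxE.
  have cu : (FracField.tofrac c)%:MP \is a @GRing.unit R.
    by apply: unit_mpolyC; rewrite tofrac_eq0.
  rewrite -[a](mulKr cu) -ae; apply: (idealM (ideal_generated_by_ideal _)).
  by apply: pull; rewrite ae; apply: idealM.
- by move=> ha; apply: ha => // _ /mapP[f /lI If ->].
- move=> hb; apply: hb => [|_ [f If ->]]; first exact: ideal_generated_by_ideal.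
  exact: pull.
move=> hb; apply: hb => [|_ /mapP[f /lI If ->]]; first exact: ideal_generated_by_ideal.
by apply: mem_ideal_generated; exists f.
Qed.

End IdealSpecialization.

Theorem proposition3p6 (k K : fieldType) (iota : {rmorphism k -> K})
    (k_infinite : infinite_set [set: k]) (m n : nat)
    (L : lmodType {mpoly {fraction {mpoly k[m]}}[n]})
    (I : {mpoly {fraction {mpoly k[m]}}[n]} -> Prop) (I_ideal : is_ideal I)
    (PL : presentation L)
    (PA : presentation (ann_mod L I))
    (PM : presentation (ideal_mul_mod L I)) :
  almost_all (fun alpha : 'I_m -> K =>
    [/\ specializable_mx iota alpha (pmx PL),
        specializable_mx iota alpha (pmx PA),
        specializable_mx iota alpha (pmx PM),
        lmod_iso (spec_mod iota alpha PA)
                 (ann_mod (spec_mod iota alpha PL) (spec_ideal iota alpha I)) &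
        lmod_iso (spec_mod iota alpha PM)
                 (ideal_mul_mod (spec_mod iota alpha PL)
                                (spec_ideal iota alpha I))]).
Proof.
have [l [lR la]] := ideal_specialization iota I_ideal.
have tP := tracked_spec_mx iota (pmx PL).
have exactL v : paug PL v = 0 <-> rowspan (pmx PL) v.
  by rewrite paug_exact rowimageP.
have surja alpha (y : coker (spec_mx iota alpha (pmx PL))) :
    exists v, coker_pi _ v = y by exists (repr y); apply: coker_repr.
have isoA : generic iota (fun alpha => lmod_iso (spec_mod iota alpha PA)
    (ann_mod (spec_mod iota alpha PL) (spec_ideal iota alpha I))).
  apply: (@submodule_specialization _ _ _ _ _ _ PL _ PA
    (fun alpha => Submodule (ann_closed _ (spec_ideal iota alpha I)))).
  (* The preimage of [0_L : I] in the free module is the colon of the relations by [l], and the same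
     [l] serves for every [alpha]. *)
  apply: tracked_ext (tracked_colon l tP) _ _ => [v|alpha v].
    rewrite (ann_generated exactL lR); split=> [h _ /mapP[f fl ->]|h f fl].
      exact: h.
    exact/h/map_f.
  rewrite (ann_generated (@coker_pi_eq0 _ _ _ _) (la alpha)).
  split=> [h _ /mapP[f fl ->]|h f fl]; first exact: h.
  exact/h/map_f.
have isoM : generic iota (fun alpha => lmod_iso (spec_mod iota alpha PM)
    (ideal_mul_mod (spec_mod iota alpha PL) (spec_ideal iota alpha I))).
  apply: (@submodule_specialization _ _ _ _ _ _ PL _ PM
    (fun alpha => Submodule (ideal_mul_closed _ (spec_ideal iota alpha I)))).
  (* Likewise the preimage of [IL] is the sum of the relations and the multiples of [l], before and
     after specialization. *)
  apply: tracked_ext (tracked_ideal_add l tP) _ _ => [v|alpha v].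
    by rewrite (ideal_mul_generated exactL (@paug_surj _ _ PL) lR).
  by rewrite (ideal_mul_generated (@coker_pi_eq0 _ _ _ _) (surja alpha) (la alpha)).
(* All five properties are generic, so one nonzero polynomial in [k[u]] controls them together. *)
apply: generic_almost_all k_infinite _.
have spL := generic_specializable iota (pmx PL).
have spA := generic_specializable iota (pmx PA).
have spM := generic_specializable iota (pmx PM).
apply: generic_imply (generic_and spL (generic_and spA (generic_and spM
  (generic_and isoA isoM)))).
by move=> alpha [? [? [? []]]]; split.
Qed.
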